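(* Let $\mathcal C$ be a category with finite colimits (with coproduct written $+$), $(\mathcal D,\otimes)$ a braided monoidal category, and $(F,\varphi)\colon(\mathcal C,+)\to(\mathcal D,\otimes)$ a lax braided monoidal functor. Then the category $F\mathrm{Cospan}$ of $F$-decorated cospans may be given a symmetric monoidal and hypergraph structure such that there is a wide embedding of hypergraph categories $$\mathrm{Cospan}(\mathcal C)\hookrightarrow F\mathrm{Cospan},$$ that is, a hypergraph functor that is faithful and bijective on objects.
   Context: $(\mathcal C,+)$ denotes $\mathcal C$ with the symmetric monoidal structure given by the coproduct, with unit the initial object $\varnothing$. $1$ denotes identity morphisms and monoidal units; $\lambda$ is the left unitor and $\sigma$ the braiding; $!$ is the unique map out of $\varnothing$; $[f,g]$ is the copairing. Decorated cospan category. An $F$-decorated cospan from $X$ to $Y$ is a cospan $X\xrightarrow{i}N\xleftarrow{o}Y$ in $\mathcal C$ together with a morphism $s\colon 1\to FN$ in $\mathcal D$ (the decoration). A morphism $(X\xrightarrow{i}N\xleftarrow{o}Y, s)\to(X\xrightarrow{i'}N'\xleftarrow{o'}Y, s')$ is a morphism $n\colon N\to N'$ in $\mathcal C$ with $n\circ i=i'$, $n\circ o=o'$, $Fn\circ s=s'$. The category $F\mathrm{Cospan}$ has as objects the objects of $\mathcal C$ and as morphisms isomorphism classes of $F$-decorated cospans; the composite of $(X \xrightarrow{i_X} N \xleftarrow{o_Y} Y, s)$ and $(Y \xrightarrow{i_Y} M \xleftarrow{o_Z} Z, t)$ is the cospan $X \xrightarrow{j_N i_X} N+_YM \xleftarrow{j_M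 o_Z} Z$ (with $j_N,j_M$ the pushout maps) decorated by $1 \xrightarrow{\lambda^{-1}} 1\otimes 1 \xrightarrow{s\otimes t} FN\otimes FM \xrightarrow{\varphi_{N,M}} F(N+M) \xrightarrow{F[j_N,j_M]} F(N+_YM)$. The identity on $X$ is the identity cospan with decoration $1\xrightarrow{\varphi_1}F\varnothing\xrightarrow{F!}FX$. Hypergraph categories. A special commutative Frobenius monoid $(X,\mu,\delta,\eta,\epsilon)$ in a symmetric monoidal category is an object $X$ with a commutative monoid structure $(\mu,\eta)$ and a cocommutative comonoid structure $(\delta,\epsilon)$ such that $(1\otimes\mu)\circ(\delta\otimes1)=\delta\circ\mu=(\mu\otimes1)\circ(1\otimes\delta)$ and $\mu\circ\delta=1_X$. A hypergraph category is a symmetric monoidal category in which each object $X$ is equipped with a special commutative Frobenius monoid structure $(X,\mu_X,\delta_X,\eta_X,\epsilon_X)$ such that $\mu_{X\otimes Y}=(\mu_X\otimes\mu_Y)\circ(1_X\otimes\sigma_{YX}\otimes1_Y)$, $\eta_{X\otimes Y}=\eta_X\otimes\eta_Y$, $\delta_{X\otimes Y}=(1_X\otimes\sigma_{XY}\otimes1_Y)\circ(\delta_X\otimes\delta_Y)$, $\epsilon_{X\otimes Y}=\epsilon_X\otimes\epsilon_Y$. A hypergraph functor $(H,\psi)$ is a strong symmetric monoidal functor such that for every object $X$ the Frobenius structure on $HX$ is $(HX,\ H\mu_X\circ\psi_{X,X},\ \psi_{X,X}^{-1}\circ H\delta_X,\ H\eta_X\circ\psi_1,\ \psi_1^{-1}\circ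 H\epsilon_X)$. The hypergraph category $\mathrm{Cospan}(\mathcal C)$. Its objects are the objects of $\mathcal C$, its morphisms are isomorphism classes of cospans in $\mathcal C$, composed by pushout. View $\mathcal C$ inside it by sending $f\colon X\to Y$ to the cospan $X\xrightarrow{f}Y\xleftarrow{1}Y$. The monoidal product is the coproduct $+$ on objects and on cospans (componentwise), with associator, unitors and braiding the images of those of $(\mathcal C,+)$. The Frobenius structure on $X$ has $\mu_X$, $\eta_X$ the images of $[1_X,1_X]\colon X+X\to X$ and $!\colon\varnothing\to X$, and $\delta_X$, $\epsilon_X$ their opposite (reflected) cospans. *)

(* Defs.v *)
From mathcomp Require Import all_boot.
From mathcomp Require Import boolp.

Set Implicit Arguments.
Unset Strict Implicit.
Unset Printing Implicit Defensive.

Section Classes.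
Variables (T : Type) (r : T -> T -> Prop).
Hypotheses (rxx : forall x, r x x) (rC : forall x y, r x y -> r y x)
           (rT : forall x y z, r x y -> r y z -> r x z).

Let e : rel {classic T} := fun x y => `[< r x y >].

Lemma classes_equiv : equiv_class_of e.
Proof.
split=> [x|x y|y x z]; first exact/asboolP.
- by apply/asboolP/asboolP; apply: rC.
- by move=> /asboolP xy /asboolP yz; apply/asboolP; apply: rT yz.
Qed.

Definition classes : Type := {eq_quot EquivRelPack classes_equiv}%qT.
Definition cls (x : T) : classes :=
  \pi_({eq_quot EquivRelPack classes_equiv})%qT (x : {classic T}).
Definition cls_repr (q : classes) : T :=
  repr (q : {eq_quot EquivRelPack classes_equiv}%qT).

Lemma cls_reprK q : cls (cls_repr q) = q.
Proof. exact: reprK. Qed.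

Lemma cls_eq x y : cls x = cls y <-> r x y.
Proof.
split=> [/(@eqmodP _ (EquivRelPack classes_equiv)) /asboolP //|xy].
by apply/(@eqmodP _ (EquivRelPack classes_equiv)); apply/asboolP.
Qed.

Lemma cls_repr_rel x : r (cls_repr (cls x)) x.
Proof. by apply/cls_eq; rewrite cls_reprK. Qed.

End Classes.

Declare Scope cat_scope.
Delimit Scope cat_scope with cat.
Local Open Scope cat_scope.

Reserved Notation "x ⊗ y" (at level 40, left associativity).
Reserved Notation "f ⊗m g" (at level 40, left associativity).

Record Category := {
  ob :> Type;
  hom : ob -> ob -> Type;
  idm : forall x, hom x x;
  comp : forall {x y z}, hom y z -> hom x y -> hom x z
    where "g \o f" := (comp g f) : cat_scope;
  compA : forall {w x y z} (h : hom y z) (g : hom x y) (f : hom w x),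
    h \o (g \o f) = (h \o g) \o f;
  comp1m : forall {x y} (f : hom x y), idm y \o f = f;
  compm1 : forall {x y} (f : hom x y), f \o idm x = f }.

Arguments hom {c} x y.
Arguments idm {c} x.
Arguments comp {c x y z} g f : rename.
Arguments compA {c w x y z} h g f.
Arguments comp1m {c x y} f.
Arguments compm1 {c x y} f.
Notation "g \o f" := (comp g f) : cat_scope.

Record Iso (C : Category) (x y : C) := {
  iso_hom :> hom x y;
  iso_inv : hom y x;
  iso_invl : iso_inv \o iso_hom = idm x;
  iso_invr : iso_hom \o iso_inv = idm y }.

Record Functor (C D : Category) := {
  fob :> C -> D;
  fmap : forall {x y}, hom x y -> hom (fob x) (fob y);
  fmap1 : forall x, fmap (idm x) = idm (fob x);
  fmapM : forall {x y z} (g : hom y z) (f : hom x y),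
    fmap (g \o f) = fmap g \o fmap f }.

Arguments fmap {C D} f {x y} g : rename.
Arguments fmapM {C D} f {x y z} g h : rename.

Definition finite_type (T : Type) :=
  exists (n : nat) (enum : 'I_n -> T), forall x, exists i, enum i = x.

Definition finite_category (J : Category) :=
  finite_type J /\ forall i j : J, finite_type (hom i j).

Record Cocone (J C : Category) (G : Functor J C) := {
  tip : C;
  leg : forall j, hom (G j) tip;
  leg_nat : forall (i j : J) (u : hom i j), leg j \o fmap G u = leg i }.

Definition is_colimit (J C : Category) (G : Functor J C) (c : Cocone G) :=
  forall d : Cocone G,
    exists! m : hom (tip c) (tip d), forall j, m \o leg c j = leg d j.

Definition has_finite_colimits (C : Category) :=
  forall (J : Category) (G : Functor J C), finite_category J ->
    exists c : Cocone G, is_colimit c.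

(** Chosen data: [+] and its monoidal structure depend on the choice, whereas
    [has_finite_colimits] only asserts existence. *)
Record Coproducts (C : Category) := {
  init : C;
  init_map : forall x, hom init x;
  init_uniq : forall {x} (f g : hom init x), f = g;
  coprod : C -> C -> C;
  cinl : forall {x y}, hom x (coprod x y);
  cinr : forall {x y}, hom y (coprod x y);
  copair : forall {x y z}, hom x z -> hom y z -> hom (coprod x y) z;
  copair_inl : forall {x y z} (f : hom x z) (g : hom y z),
    copair f g \o cinl = f;
  copair_inr : forall {x y z} (f : hom x z) (g : hom y z),
    copair f g \o cinr = g;
  copair_uniq : forall {x y z} (u v : hom (coprod x y) z),
    u \o cinl = v \o cinl -> u \o cinr = v \o cinr -> u = v }.

Arguments init {C} c.
Arguments init_map {C} c x.
Arguments init_uniq {C} c {x} f g.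
Arguments coprod {C} c x y.
Arguments cinl {C} c {x y}.
Arguments cinr {C} c {x y}.
Arguments copair {C} c {x y z} f g.

Record Monoidal (C : Category) := {
  munit : C;
  tens : C -> C -> C where "x ⊗ y" := (tens x y) : cat_scope;
  tensm : forall {x x' y y' : C}, hom x x' -> hom y y' -> hom (x ⊗ y) (x' ⊗ y')
    where "f ⊗m g" := (tensm f g) : cat_scope;
  tensm1 : forall x y, idm x ⊗m idm y = idm (x ⊗ y);
  tensmM : forall {x x' x'' y y' y'' : C} (f' : hom x' x'') (f : hom x x')
      (g' : hom y' y'') (g : hom y y'),
    (f' \o f) ⊗m (g' \o g) = (f' ⊗m g') \o (f ⊗m g);
  assoc : forall x y z, Iso ((x ⊗ y) ⊗ z) (x ⊗ (y ⊗ z));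
  lunit : forall x, Iso (munit ⊗ x) x;
  runit : forall x, Iso (x ⊗ munit) x;
  assoc_nat : forall {x x' y y' z z' : C}
      (f : hom x x') (g : hom y y') (h : hom z z'),
    assoc x' y' z' \o ((f ⊗m g) ⊗m h) = (f ⊗m (g ⊗m h)) \o assoc x y z;
  lunit_nat : forall {x x' : C} (f : hom x x'),
    lunit x' \o (idm munit ⊗m f) = f \o lunit x;
  runit_nat : forall {x x' : C} (f : hom x x'),
    runit x' \o (f ⊗m idm munit) = f \o runit x;
  pentagon : forall w x y z : C,
    ((idm w ⊗m assoc x y z) \o assoc w (x ⊗ y) z) \o (assoc w x y ⊗m idm z)
    = assoc w x (y ⊗ z) \o assoc (w ⊗ x) y z;
  triangle : forall x y : C,
    (idm x ⊗m lunit y) \o assoc x munit y = runit x ⊗m idm y }.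

Arguments munit {C} m.
Arguments tens {C} m x y.
Arguments tensm {C} m {x x' y y'} f g : rename.
Arguments tensmM {C} m {x x' x'' y y' y''} f' f g' g : rename.
Arguments assoc {C} m x y z.
Arguments lunit {C} m x.
Arguments runit {C} m x.

Record Braided (C : Category) := {
  bmon :> Monoidal C;
  braid : forall x y, Iso (tens bmon x y) (tens bmon y x)
    where "x ⊗ y" := (tens bmon x y) and "f ⊗m g" := (tensm bmon f g);
  braid_nat : forall {x x' y y' : C} (f : hom x x') (g : hom y y'),
    braid x' y' \o (f ⊗m g) = (g ⊗m f) \o braid x y;
  hexagon1 : forall x y z : C,
    (assoc bmon y z x \o braid x (y ⊗ z)) \o assoc bmon x y z
    = ((idm y ⊗m braid x z) \o assoc bmon y x z) \o (braid x y ⊗m idm z);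
  hexagon2 : forall x y z : C,
    (iso_inv (assoc bmon z x y) \o braid (x ⊗ y) z) \o iso_inv (assoc bmon x y z)
    = ((braid x z ⊗m idm y) \o iso_inv (assoc bmon x z y))
        \o (idm x ⊗m braid y z) }.

Arguments braid {C} b x y.

Record Symmetric (C : Category) := {
  sbraided :> Braided C;
  braidK : forall x y : C, braid sbraided y x \o braid sbraided x y = idm _ }.

Record LaxBraidedFunctor (C D : Category) (M : Braided C) (N : Braided D) := {
  lfun :> Functor C D;
  lax2 : forall x y : C, hom (tens N (lfun x) (lfun y)) (lfun (tens M x y));
  lax0 : hom (munit N) (lfun (munit M));
  lax2_nat : forall {x x' y y' : C} (f : hom x x') (g : hom y y'),
    lax2 x' y' \o tensm N (fmap lfun f) (fmap lfun g)
    = fmap lfun (tensm M f g) \o lax2 x y;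
  lax_assoc : forall x y z : C,
    (fmap lfun (assoc M x y z) \o lax2 (tens M x y) z) \o tensm N (lax2 x y) (idm _)
    = (lax2 x (tens M y z) \o tensm N (idm _) (lax2 y z))
        \o assoc N (lfun x) (lfun y) (lfun z);
  lax_lunit : forall x : C,
    (fmap lfun (lunit M x) \o lax2 (munit M) x) \o tensm N lax0 (idm _)
    = lunit N (lfun x);
  lax_runit : forall x : C,
    (fmap lfun (runit M x) \o lax2 x (munit M)) \o tensm N (idm _) lax0
    = runit N (lfun x);
  lax_braid : forall x y : C,
    fmap lfun (braid M x y) \o lax2 x y
    = lax2 y x \o braid N (lfun x) (lfun y) }.

Arguments lax2 {C D M N} l x y.
Arguments lax0 {C D M N} l.

(** Between symmetric monoidal categories, a braided monoidal functor is the
    same thing as a symmetric monoidal functor. *)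
Record StrongSymmetricFunctor (C D : Category)
    (M : Symmetric C) (N : Symmetric D) := {
  sfun :> LaxBraidedFunctor M N;
  strong2_inv : forall x y : C, hom (sfun (tens M x y)) (tens N (sfun x) (sfun y));
  strong0_inv : hom (sfun (munit M)) (munit N);
  strong2_invl : forall x y, strong2_inv x y \o lax2 sfun x y = idm _;
  strong2_invr : forall x y, lax2 sfun x y \o strong2_inv x y = idm _;
  strong0_invl : strong0_inv \o lax0 sfun = idm _;
  strong0_invr : lax0 sfun \o strong0_inv = idm _ }.

Arguments strong2_inv {C D M N} s x y.
Arguments strong0_inv {C D M N} s.

Record SCFMonoid (C : Category) (M : Symmetric C) (x : C) := {
  mu : hom (tens M x x) x
    where "f ⊗m g" := (tensm M f g);
  eta : hom (munit M) x;
  delta : hom x (tens M x x);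
  eps : hom x (munit M);
  mu_assoc : mu \o (mu ⊗m idm x) = mu \o (idm x ⊗m mu) \o assoc M x x x;
  mu_unitl : mu \o (eta ⊗m idm x) = lunit M x;
  mu_unitr : mu \o (idm x ⊗m eta) = runit M x;
  mu_comm : mu \o braid M x x = mu;
  delta_assoc : assoc M x x x \o (delta ⊗m idm x) \o delta = (idm x ⊗m delta) \o delta;
  delta_unitl : (eps ⊗m idm x) \o delta = iso_inv (lunit M x);
  delta_unitr : (idm x ⊗m eps) \o delta = iso_inv (runit M x);
  delta_comm : braid M x x \o delta = delta;
  frobenius_l : (idm x ⊗m mu) \o assoc M x x x \o (delta ⊗m idm x) = delta \o mu;
  frobenius_r : (mu ⊗m idm x) \o iso_inv (assoc M x x x) \o (idm x ⊗m delta)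
    = delta \o mu;
  special : mu \o delta = idm x }.

(** The middle-four interchange [1 ⊗ σ ⊗ 1], with its associators. *)
Definition interchange (C : Category) (M : Symmetric C) (w x y z : C) :
    hom (tens M (tens M w x) (tens M y z)) (tens M (tens M w y) (tens M x z)) :=
  iso_inv (assoc M w y (tens M x z))
  \o tensm M (idm w)
       (assoc M y x z \o tensm M (braid M x y) (idm z) \o iso_inv (assoc M x y z))
  \o assoc M w x (tens M y z).

Record Hypergraph (C : Category) := {
  hsym :> Symmetric C;
  frob : forall x : C, SCFMonoid hsym x
    where "x ⊗ y" := (tens hsym x y) and "f ⊗m g" := (tensm hsym f g);
  mu_tens : forall x y : C,
    mu (frob (x ⊗ y))
    = (mu (frob x) ⊗m mu (frob y)) \o interchange hsym x y x y;
  eta_tens : forall x y : C,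
    eta (frob (x ⊗ y))
    = (eta (frob x) ⊗m eta (frob y)) \o iso_inv (lunit hsym (munit hsym));
  delta_tens : forall x y : C,
    delta (frob (x ⊗ y))
    = interchange hsym x x y y \o (delta (frob x) ⊗m delta (frob y));
  eps_tens : forall x y : C,
    eps (frob (x ⊗ y))
    = lunit hsym (munit hsym) \o (eps (frob x) ⊗m eps (frob y)) }.

Record HypergraphFunctor (C D : Category)
    (M : Hypergraph C) (N : Hypergraph D) := {
  hfun :> StrongSymmetricFunctor M N;
  hfun_mu : forall x : C,
    mu (frob N (hfun x)) = fmap hfun (mu (frob M x)) \o lax2 hfun x x;
  hfun_delta : forall x : C,
    delta (frob N (hfun x)) = strong2_inv hfun x x \o fmap hfun (delta (frob M x));
  hfun_eta : forall x : C,
    eta (frob N (hfun x)) = fmap hfun (eta (frob M x)) \o lax0 hfun;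
  hfun_eps : forall x : C,
    eps (frob N (hfun x)) = strong0_inv hfun \o fmap hfun (eps (frob M x)) }.

Definition faithful (C D : Category) (F : Functor C D) :=
  forall x y : C, injective (@fmap C D F x y).

Definition wide_embedding (C D : Category) (F : Functor C D) :=
  faithful F /\ bijective (fob F).

Section CategoryLemmas.
Variable C : Category.
Implicit Types w x y z : C.

Lemma compAr w x y z (h : hom y z) (g : hom x y) (f : hom w x) :
  (h \o g) \o f = h \o (g \o f).
Proof. by rewrite compA. Qed.

Lemma whisker w x y z (h : hom y z) (g : hom x y) (f : hom w x) (k : hom w y) :
  g \o f = k -> h \o g \o f = h \o k.
Proof. by move=> <-; rewrite compA. Qed.

Lemma whisker_r w x y z (h : hom y z) (g : hom x y) (f : hom w x) (k : hom x z) :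
  h \o g = k -> h \o (g \o f) = k \o f.
Proof. by move=> <-; rewrite compA. Qed.

Definition iso_id x : Iso x x := Build_Iso (comp1m (idm x)) (comp1m (idm x)).

Definition iso_sym x y (i : Iso x y) : Iso y x :=
  Build_Iso (iso_invr i) (iso_invl i).

Definition iso_comp x y z (j : Iso y z) (i : Iso x y) : Iso x z.
Proof.
exists (j \o i) (iso_inv i \o iso_inv j).
- abstract (by rewrite compA (whisker _ (iso_invl j)) compm1 iso_invl).
- abstract (by rewrite compA (whisker _ (iso_invr i)) compm1 iso_invr).
Defined.

Lemma iso_epi x y z (i : Iso x y) (f g : hom y z) : f \o i = g \o i -> f = g.
Proof.
by move=> /(congr1 (fun h => h \o iso_inv i)); rewrite !compAr iso_invr !compm1.
Qed.

Lemma iso_mono x y z (i : Iso y z) (f g : hom x y) : i \o f = i \o g -> f = g.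
Proof.
by move=> /(congr1 (fun h => iso_inv i \o h)); rewrite !compA iso_invl !comp1m.
Qed.

End CategoryLemmas.

Section CoproductMonoidal.
Variables (C : Category) (S : Coproducts C).
Implicit Types w x y z : C.

Local Notation "x + y" := (coprod S x y).
Local Notation "[ f , g ]" := (copair S f g).
Local Notation "0" := (init S).

Definition coprod_map x x' y y' (f : hom x x') (g : hom y y') :
  hom (x + y) (x' + y') := [cinl S \o f, cinr S \o g].
Local Notation "f +m g" := (coprod_map f g) (at level 40, left associativity).

Lemma copair_inlA w x y z (f : hom x z) (g : hom y z) (h : hom w x) :
  [f, g] \o (cinl S \o h) = f \o h.
Proof. by rewrite compA copair_inl. Qed.

Lemma copair_inrA w x y z (f : hom x z) (g : hom y z) (h : hom w y) :
  [f, g] \o (cinr S \o h) = g \o h.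
Proof. by rewrite compA copair_inr. Qed.

Definition copairE :=
  (@comp1m C, @compm1 C, @compAr C, @copair_inl C S, @copair_inr C S,
   @copair_inlA, @copair_inrA).

Ltac coprod_tac := rewrite /coprod_map /=;
  repeat (apply: init_uniq || apply: copair_uniq); rewrite ?copairE //.

Lemma comp_copair w x y z (h : hom z w) (f : hom x z) (g : hom y z) :
  h \o [f, g] = [h \o f, h \o g].
Proof. by coprod_tac. Qed.

Lemma copair_map x x' y y' z (f : hom x x') (g : hom y y')
  (h : hom x' z) (k : hom y' z) : [h, k] \o (f +m g) = [h \o f, k \o g].
Proof. by coprod_tac. Qed.

Lemma coprod_map1 x y : idm x +m idm y = idm (x + y).
Proof. by coprod_tac. Qed.

Lemma coprod_mapM x x' x'' y y' y'' (f' : hom x' x'') (f : hom x x')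
    (g' : hom y' y'') (g : hom y y') :
  (f' \o f) +m (g' \o g) = (f' +m g') \o (f +m g).
Proof. by coprod_tac. Qed.

Definition coprod_assoc x y z : Iso ((x + y) + z) (x + (y + z)).
Proof.
exists [[cinl S, cinr S \o cinl S], cinr S \o cinr S]
       [cinl S \o cinl S, [cinl S \o cinr S, cinr S]];
abstract (by coprod_tac).
Defined.

Definition coprod_lunit x : Iso (0 + x) x.
Proof. exists [init_map S x, idm x] (cinr S); abstract (by coprod_tac). Defined.

Definition coprod_runit x : Iso (x + 0) x.
Proof. exists [idm x, init_map S x] (cinl S); abstract (by coprod_tac). Defined.

Definition coprod_braid x y : Iso (x + y) (y + x).
Proof. exists [cinr S, cinl S] [cinr S, cinl S]; abstract (by coprod_tac). Defined.

Definition coprod_monoidal : Monoidal C.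
Proof.
exists 0 (coprod S) coprod_map coprod_assoc coprod_lunit coprod_runit;
  abstract (move=> *; first [exact: coprod_map1 | exact: coprod_mapM | by coprod_tac]).
Defined.

Definition coprod_braided : Braided C.
Proof. exists coprod_monoidal coprod_braid; move=> *; abstract (by coprod_tac). Defined.

Definition coprod_symmetric : Symmetric C.
Proof. exists coprod_braided; move=> *; abstract (by coprod_tac). Defined.

End CoproductMonoidal.

Record is_pushout (C : Category) (x n m p : C) (f : hom x n) (g : hom x m)
    (j : hom n p) (k : hom m p) : Prop := {
  po_comm : j \o f = k \o g;
  po_univ : forall (t : C) (a : hom n t) (b : hom m t), a \o f = b \o g ->
    exists! u : hom p t, u \o j = a /\ u \o k = b }.

Record pushout (C : Category) (x n m : C) (f : hom x n) (g : hom x m) := {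
  po_tip : C;
  po_inl : hom n po_tip;
  po_inr : hom m po_tip;
  po_is_pushout : is_pushout f g po_inl po_inr }.

Inductive span_ob := span_src | span_left | span_right.

Definition span_hom (i j : span_ob) : Type :=
  match i, j with
  | span_src, _ | span_left, span_left | span_right, span_right => unit
  | _, _ => void
  end.

Definition span_id (i : span_ob) : span_hom i i :=
  match i with span_src | span_left | span_right => tt end.

Definition span_comp (i j k : span_ob) :
    span_hom j k -> span_hom i j -> span_hom i k.
Proof. by case: i j k => [] [] []. Defined.

Definition span_category : Category.
Proof.
exists span_ob span_hom span_id span_comp.
- by case; case; case; case=> //= [] [] [] [].
- by case; case=> //= [] [].
- by case; case=> //= [] [].
Defined.

Lemma span_finite : finite_category span_category.
Proof.
split.
- exists 3, (fun i : 'I_3 => nth span_src [:: span_src; span_left; span_right] i).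
  by case; [exists (inord 0) | exists (inord 1) | exists (inord 2)];
     rewrite inordK.
- have empty : finite_type void.
    by exists 0; unshelve eexists; [case | case].
  by case; case => //; exists 1, (fun=> tt); case; exists ord0.
Qed.

Section Span.
Variables (C : Category) (x n m : C) (f : hom x n) (g : hom x m).

Definition span_fob (i : span_category) : C :=
  match i with span_src => x | span_left => n | span_right => m end.

Definition span_fmap (i j : span_category) :
    @hom span_category i j -> hom (span_fob i) (span_fob j) :=
  match i, j return @hom span_category i j -> hom (span_fob i) (span_fob j) with
  | span_src, span_src => fun=> idm x
  | span_src, span_left => fun=> f
  | span_src, span_right => fun=> g
  | span_left, span_left => fun=> idm n
  | span_right, span_right => fun=> idm m
  | _, _ => fun v => match v with end
  end.

Definition span_functor : Functor span_category C.
Proof.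
exists span_fob span_fmap; first by case.
by case; case; case=> //= *; rewrite ?comp1m ?compm1.
Defined.

Definition span_cocone (p : C) (j : hom n p) (k : hom m p)
  (e : j \o f = k \o g) : Cocone span_functor.
Proof.
exists p (fun i => match i return hom (span_fob i) p with
          span_src => j \o f | span_left => j | span_right => k end).
by case; case=> //= *; rewrite ?compm1.
Defined.

Lemma pushout_exists : has_finite_colimits C -> exists _ : pushout f g, True.
Proof.
move=> /(_ _ span_functor span_finite)[c cP].
have cl : leg c span_left \o f = leg c span_src.
  exact: (@leg_nat _ _ _ c span_src span_left tt).
have cr : leg c span_right \o g = leg c span_src.
  exact: (@leg_nat _ _ _ c span_src span_right tt).
unshelve eexists; last by [].
exists (tip c) (leg c span_left) (leg c span_right).
split=> [|t a b ab]; first by rewrite cl cr.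
have [u [uP uU]] := cP (span_cocone ab).
exists u; split=> [|v [va vb]].
  by split; [exact: (uP span_left) | exact: (uP span_right)].
by apply: uU; case=> //=; rewrite -cl compA va.
Qed.

(** The choice of a pushout is immaterial: composites of cospans are only
    considered up to isomorphism. *)
Definition choose_pushout (hC : has_finite_colimits C) : pushout f g :=
  projT1 (cid (pushout_exists hC)).

End Span.

Section PushoutLemmas.
Variable C : Category.
Implicit Types x y z n m p q r t : C.

Lemma po_uniq x n m p (f : hom x n) (g : hom x m) (j : hom n p) (k : hom m p) t
    (u v : hom p t) :
  is_pushout f g j k -> u \o j = v \o j -> u \o k = v \o k -> u = v.
Proof.
move=> [e univ] uj uk.
have [|w [_ wU]] := univ t (v \o j) (v \o k); first by rewrite !compAr e.
by rewrite -(wU u) ?(wU v).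
Qed.

Lemma po_ex x n m p (f : hom x n) (g : hom x m) (j : hom n p) (k : hom m p) t
    (a : hom n t) (b : hom m t) :
  is_pushout f g j k -> a \o f = b \o g ->
  exists u : hom p t, u \o j = a /\ u \o k = b.
Proof. by move=> [_ univ] /univ[u [? _]]; exists u. Qed.

Lemma is_pushoutI x n m p (f : hom x n) (g : hom x m) (j : hom n p) (k : hom m p) :
  j \o f = k \o g ->
  (forall t (a : hom n t) (b : hom m t), a \o f = b \o g ->
    exists u : hom p t, u \o j = a /\ u \o k = b) ->
  (forall t (u v : hom p t), u \o j = v \o j -> u \o k = v \o k -> u = v) ->
  is_pushout f g j k.
Proof.
move=> e ex un; split=> // t a b /ex[u [ua ub]].
by exists u; split=> // v [va vb]; apply: un; rewrite ?ua ?ub ?va ?vb.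
Qed.

Lemma pushout_sym x n m p (f : hom x n) (g : hom x m) (j : hom n p) (k : hom m p) :
  is_pushout f g j k -> is_pushout g f k j.
Proof.
move=> P; apply: is_pushoutI; first by rewrite (po_comm P).
- move=> t a b /esym ab; have [u [? ?]] := po_ex P ab; by exists u.
- by move=> t u v uk uj; apply: (po_uniq P).
Qed.

Lemma pushout_idl x m (g : hom x m) : is_pushout (idm x) g g (idm m).
Proof.
apply: is_pushoutI; rewrite ?compm1 ?comp1m //.
- by move=> t a b; rewrite compm1 => ->; exists b; rewrite compm1.
- by move=> t u v _; rewrite !compm1.
Qed.

Lemma pushout_idr x n (f : hom x n) : is_pushout f (idm x) (idm n) f.
Proof. exact/pushout_sym/pushout_idl. Qed.

Lemma pushout_iso x n m p n' m' p' (f : hom x n) (g : hom x m)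
    (j : hom n p) (k : hom m p) (f' : hom x n') (g' : hom x m')
    (j' : hom n' p') (k' : hom m' p') (a : Iso n n') (b : Iso m m') :
  is_pushout f g j k -> is_pushout f' g' j' k' ->
  a \o f = f' -> b \o g = g' ->
  exists u : Iso p p', u \o j = j' \o a /\ u \o k = k' \o b.
Proof.
move=> P P' af bg.
have [|u [uj uk]] := @po_ex _ _ _ _ _ _ _ _ _ (j' \o a) (k' \o b) P.
  by rewrite !compAr af bg (po_comm P').
have [|v [vj vk]] := @po_ex _ _ _ _ _ _ _ _ _ (j \o iso_inv a) (k \o iso_inv b) P'.
  by rewrite -af -bg !compA (whisker _ (iso_invl a)) (whisker _ (iso_invl b))
             !compm1 (po_comm P).
unshelve eexists; [exists u v | by split].
- apply: (po_uniq P); rewrite !compAr (uj, uk) compA (vj, vk) compAr iso_invl.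
    by rewrite compm1 comp1m.
  by rewrite compm1 comp1m.
- apply: (po_uniq P'); rewrite !compAr (vj, vk) compA (uj, uk) compAr iso_invr.
    by rewrite compm1 comp1m.
  by rewrite compm1 comp1m.
Qed.

Lemma pushout_paste y z n m l p q r (f : hom y n) (g : hom y m)
    (h : hom z m) (i : hom z l) (p1 : hom n p) (p2 : hom m p)
    (q1 : hom m q) (q2 : hom l q) (r1 : hom p r) (r2 : hom l r) :
  is_pushout f g p1 p2 -> is_pushout h i q1 q2 ->
  is_pushout (p2 \o h) i r1 r2 ->
  exists v : hom q r, [/\ v \o q1 = r1 \o p2, v \o q2 = r2 &
    is_pushout f (q1 \o g) (r1 \o p1) v].
Proof.
move=> P Q R.
have [|v [v1 v2]] := @po_ex _ _ _ _ _ _ _ _ _ (r1 \o p2) r2 Q.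
  by rewrite -(po_comm R) compA.
exists v; split=> //; apply: is_pushoutI.
- by rewrite compAr (po_comm P) !compA v1.
- move=> t a b; rewrite compA => ab; have [c [c1 c2]] := po_ex P ab.
  have [|u [u1 u2]] := @po_ex _ _ _ _ _ _ _ _ _ c (b \o q2) R.
    by rewrite compA c2 !compAr (po_comm Q).
  exists u; split; first by rewrite compA u1.
  by apply: (po_uniq Q); rewrite compAr ?v1 ?v2 // compA u1.
- move=> t u w; rewrite !compA => e1 e2.
  apply: (po_uniq R).
    apply: (po_uniq P) => //.
    by rewrite !compAr -v1 !compA e2.
  by rewrite -v2 !compA e2.
Qed.

End PushoutLemmas.

Record cospan (C : Category) (X Y : C) := {
  apex : C;
  lleg : hom X apex;
  rleg : hom Y apex }.

Arguments Build_cospan {C X Y} apex lleg rleg.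

Definition cospan_morphism (C : Category) (X Y : C) (c d : cospan X Y)
    (n : hom (apex c) (apex d)) :=
  n \o lleg c = lleg d /\ n \o rleg c = rleg d.

Definition cospan_iso (C : Category) (X Y : C) (c d : cospan X Y) :=
  exists (n : hom (apex c) (apex d)) (n' : hom (apex d) (apex c)),
    [/\ cospan_morphism n, cospan_morphism n', n' \o n = idm _ & n \o n' = idm _].

Section CospanCategory.
Variables (C : Category) (hC : has_finite_colimits C).
Implicit Types X Y Z W : C.

Lemma cospan_isoP X Y (c d : cospan X Y) :
  cospan_iso c d <-> exists n : Iso (apex c) (apex d), cospan_morphism n.
Proof.
split=> [[n [n' [nP _ nl nr]]]|[n [nl nr]]].
  by exists (Build_Iso nl nr).
exists n, (iso_inv n); split=> //; rewrite ?iso_invl ?iso_invr //.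
by split; rewrite -?nl -?nr compA iso_invl comp1m.
Qed.

Lemma cospan_iso_refl X Y (c : cospan X Y) : cospan_iso c c.
Proof. by apply/cospan_isoP; exists (iso_id _); split; rewrite comp1m. Qed.

Lemma cospan_iso_sym X Y (c d : cospan X Y) : cospan_iso c d -> cospan_iso d c.
Proof. by move=> [n [n' [? ? ? ?]]]; exists n', n. Qed.

Lemma cospan_iso_trans X Y (c d e : cospan X Y) :
  cospan_iso c d -> cospan_iso d e -> cospan_iso c e.
Proof.
move=> /cospan_isoP[n [nl nr]] /cospan_isoP[m [ml mr]].
by apply/cospan_isoP; exists (iso_comp m n); split; rewrite /= compAr ?nl ?nr.
Qed.

Definition cospan_class X Y : Type :=
  classes (@cospan_iso_refl X Y) (@cospan_iso_sym X Y) (@cospan_iso_trans X Y).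

Definition cospan_cls X Y (c : cospan X Y) : cospan_class X Y := cls _ _ _ c.

Lemma cospan_cls_eq X Y (c d : cospan X Y) :
  cospan_cls c = cospan_cls d <-> cospan_iso c d.
Proof. exact: cls_eq. Qed.

Lemma cospan_clsI X Y (c d : cospan X Y) (n : Iso (apex c) (apex d)) :
  n \o lleg c = lleg d -> n \o rleg c = rleg d -> cospan_cls c = cospan_cls d.
Proof. by move=> nl nr; apply/cospan_cls_eq/cospan_isoP; exists n. Qed.

Definition cospan_comp X Y Z (a : cospan X Y) (b : cospan Y Z) : cospan X Z :=
  let p := choose_pushout (rleg a) (lleg b) hC in
  Build_cospan (po_tip p) (po_inl p \o lleg a) (po_inr p \o rleg b).

Definition cospan_idm X : cospan_class X X :=
  cospan_cls (Build_cospan X (idm X) (idm X)).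

Definition cospan_class_comp X Y Z (g : cospan_class Y Z) (f : cospan_class X Y) :
    cospan_class X Z :=
  cospan_cls (cospan_comp (cls_repr f) (cls_repr g)).

(** The composite may be computed with any representatives and any pushout. *)
Lemma cospan_comp_cls X Y Z n m p (al : hom X n) (ar : hom Y n) (bl : hom Y m)
    (br : hom Z m) (j : hom n p) (k : hom m p) :
  is_pushout ar bl j k ->
  cospan_class_comp (cospan_cls (Build_cospan m bl br))
    (cospan_cls (Build_cospan n al ar))
  = cospan_cls (Build_cospan p (j \o al) (k \o br)).
Proof.
set a := Build_cospan n al ar; set b := Build_cospan m bl br.
move=> P; rewrite /cospan_class_comp /cospan_comp.
have /cospan_isoP[u [ul ur]] : cospan_iso (cls_repr (cospan_cls a)) a.
  exact: cls_repr_rel.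
have /cospan_isoP[v [vl vr]] : cospan_iso (cls_repr (cospan_cls b)) b.
  exact: cls_repr_rel.
set q := choose_pushout _ _ _.
have [w [wj wk]] := pushout_iso (po_is_pushout q) P ur vl.
apply/cospan_cls_eq/cospan_isoP; exists w.
by split; rewrite /= compA (wj, wk) compAr (ul, vr).
Qed.

Lemma cospan_clsW X Y (P : cospan_class X Y -> Prop) :
  (forall n l r, P (cospan_cls (Build_cospan n l r))) -> forall f, P f.
Proof. by move=> H f; rewrite -(cls_reprK f); case: (cls_repr f). Qed.

Lemma cospan_class_compA W X Y Z (h : cospan_class Y Z) (g : cospan_class X Y)
    (f : cospan_class W X) :
  cospan_class_comp h (cospan_class_comp g f)
  = cospan_class_comp (cospan_class_comp h g) f.
Proof.
elim/cospan_clsW: f => n fl fr; elim/cospan_clsW: g => m gl gr.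
elim/cospan_clsW: h => l hl hr.
pose p := choose_pushout fr gl hC; pose q := choose_pushout gr hl hC.
pose r := choose_pushout (po_inr p \o gr) hl hC.
have [v [v1 v2 V]] :=
  pushout_paste (po_is_pushout p) (po_is_pushout q) (po_is_pushout r).
rewrite (cospan_comp_cls _ _ (po_is_pushout p)) (cospan_comp_cls _ _ (po_is_pushout r)).
rewrite (cospan_comp_cls _ _ (po_is_pushout q)) (cospan_comp_cls _ _ V) /=.
by rewrite !compA v2.
Qed.

Lemma cospan_class_comp1m X Y (f : cospan_class X Y) :
  cospan_class_comp (cospan_idm Y) f = f.
Proof.
elim/cospan_clsW: f => n l r.
by rewrite (cospan_comp_cls _ _ (pushout_idr r)) /= comp1m compm1.
Qed.

Lemma cospan_class_compm1 X Y (f : cospan_class X Y) :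
  cospan_class_comp f (cospan_idm X) = f.
Proof.
elim/cospan_clsW: f => n l r.
by rewrite (cospan_comp_cls _ _ (pushout_idl l)) /= comp1m compm1.
Qed.

Definition Cospan : Category := {|
  ob := ob C;
  hom := cospan_class;
  idm := cospan_idm;
  comp := cospan_class_comp;
  compA := cospan_class_compA;
  comp1m := cospan_class_comp1m;
  compm1 := cospan_class_compm1 |}.

End CospanCategory.

Section CospanHypergraph.
Variables (C : Category) (S : Coproducts C) (hC : has_finite_colimits C).
Implicit Types X Y Z W : C.

Local Notation K := (Cospan hC).
Local Notation "x + y" := (coprod S x y).
Local Notation "f +m g" := (coprod_map S f g) (at level 40, left associativity).
Local Notation "[ f , g ]" := (copair S f g).
Local Notation "0" := (init S).

Definition csp X Y n (l : hom X n) (r : hom Y n) : @hom K X Y :=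
  cospan_cls (Build_cospan n l r).

Definition cospan_of X Y (f : hom X Y) : @hom K X Y := csp f (idm Y).
Definition cospan_op X Y (f : hom X Y) : @hom K Y X := csp (idm Y) f.

Definition cospan_sum X X' Y Y' (c : cospan X X') (d : cospan Y Y') :
    cospan (X + Y) (X' + Y') :=
  Build_cospan (apex c + apex d) (lleg c +m lleg d) (rleg c +m rleg d).

Definition cospan_tensm X X' Y Y' (f : @hom K X X') (g : @hom K Y Y') :
    @hom K (X + Y) (X' + Y') :=
  cospan_cls (cospan_sum (cls_repr f) (cls_repr g)).

Definition coprod_iso X X' Y Y' (i : Iso X X') (j : Iso Y Y') :
  Iso (X + Y) (X' + Y').
Proof.
exists (i +m j) (iso_inv i +m iso_inv j).
- abstract (by rewrite -coprod_mapM !iso_invl coprod_map1).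
- abstract (by rewrite -coprod_mapM !iso_invr coprod_map1).
Defined.

Lemma cspW X Y (P : @hom K X Y -> Prop) :
  (forall n (l : hom X n) (r : hom Y n), P (csp l r)) -> forall f, P f.
Proof. exact: cospan_clsW. Qed.

Lemma cspI X Y n m (l : hom X n) (r : hom Y n) (l' : hom X m) (r' : hom Y m)
    (i : Iso n m) : i \o l = l' -> i \o r = r' -> csp l r = csp l' r'.
Proof. by move=> il ir; apply/cospan_cls_eq/cospan_isoP; exists i. Qed.

Lemma csp_comp X Y Z n m p (al : hom X n) (ar : hom Y n) (bl : hom Y m)
    (br : hom Z m) (j : hom n p) (k : hom m p) :
  is_pushout ar bl j k ->
  csp bl br \o csp al ar = csp (j \o al) (k \o br).
Proof. exact: cospan_comp_cls. Qed.

Lemma csp_tensm X X' Y Y' n m (l : hom X n) (r : hom X' n) (l' : hom Y m)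
    (r' : hom Y' m) :
  cospan_tensm (csp l r) (csp l' r') = csp (l +m l') (r +m r').
Proof.
rewrite /cospan_tensm /cospan_sum /csp.
set c := Build_cospan n l r; set d := Build_cospan m l' r'.
have /cospan_isoP[i [il ir]] : cospan_iso (cls_repr (cospan_cls c)) c.
  exact: cls_repr_rel.
have /cospan_isoP[j [jl jr]] : cospan_iso (cls_repr (cospan_cls d)) d.
  exact: cls_repr_rel.
apply/cospan_cls_eq/cospan_isoP; exists (coprod_iso i j).
by split; rewrite /= -coprod_mapM ?(il, ir) ?(jl, jr).
Qed.

Lemma pushout_coprod x n m p x' n' m' p' (f : hom x n) (g : hom x m)
    (j : hom n p) (k : hom m p) (f' : hom x' n') (g' : hom x' m')
    (j' : hom n' p') (k' : hom m' p') :
  is_pushout f g j k -> is_pushout f' g' j' k' ->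
  is_pushout (f +m f') (g +m g') (j +m j') (k +m k').
Proof.
move=> P P'; apply: is_pushoutI.
- by rewrite -!coprod_mapM (po_comm P) (po_comm P').
- move=> t a b ab.
  have [|u [u1 u2]] := @po_ex _ _ _ _ _ _ _ _ _ _ (a \o cinl S) (b \o cinl S) P.
    move: (congr1 (fun h => h \o cinl S) ab).
    by rewrite /coprod_map !copairE.
  have [|v [v1 v2]] := @po_ex _ _ _ _ _ _ _ _ _ _ (a \o cinr S) (b \o cinr S) P'.
    move: (congr1 (fun h => h \o cinr S) ab).
    by rewrite /coprod_map !copairE.
  exists [u, v]; rewrite !copair_map u1 u2 v1 v2.
  by split; apply: copair_uniq; rewrite !copairE.
- move=> t u v e1 e2; apply: copair_uniq.
    apply: (po_uniq P).
      move: (congr1 (fun h => h \o cinl S) e1).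
      by rewrite /coprod_map !copairE.
    move: (congr1 (fun h => h \o cinl S) e2).
    by rewrite /coprod_map !copairE.
  apply: (po_uniq P').
    move: (congr1 (fun h => h \o cinr S) e1).
    by rewrite /coprod_map !copairE.
  move: (congr1 (fun h => h \o cinr S) e2).
  by rewrite /coprod_map !copairE.
Qed.

Lemma cospan_tensm1 X Y :
  cospan_tensm (@idm K X) (@idm K Y) = @idm K (X + Y).
Proof. by rewrite [LHS]csp_tensm !coprod_map1. Qed.

Lemma cospan_tensmM X X' X'' Y Y' Y'' (f' : @hom K X' X'') (f : @hom K X X')
    (g' : @hom K Y' Y'') (g : @hom K Y Y') :
  cospan_tensm (f' \o f) (g' \o g) = cospan_tensm f' g' \o cospan_tensm f g.
Proof.
elim/cspW: f => n fl fr; elim/cspW: f' => n' fl' fr'.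
elim/cspW: g => m gl gr; elim/cspW: g' => m' gl' gr'.
have P := po_is_pushout (choose_pushout fr fl' hC).
have Q := po_is_pushout (choose_pushout gr gl' hC).
rewrite (csp_comp _ _ P) (csp_comp _ _ Q) !csp_tensm.
by rewrite (csp_comp _ _ (pushout_coprod P Q)) !coprod_mapM.
Qed.

Lemma cospan_ofM X Y Z (g : hom Y Z) (f : hom X Y) :
  cospan_of (g \o f) = cospan_of g \o cospan_of f.
Proof. by rewrite (csp_comp _ _ (pushout_idl g)) comp1m. Qed.

Lemma cospan_opM X Y Z (g : hom Y Z) (f : hom X Y) :
  cospan_op (g \o f) = cospan_op f \o cospan_op g.
Proof. by rewrite (csp_comp _ _ (pushout_idr g)) comp1m. Qed.

Lemma cospan_of_op X Y Z (f : hom X Z) (g : hom Y Z) :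
  cospan_op g \o cospan_of f = csp f g.
Proof. by rewrite (csp_comp _ _ (pushout_idl (idm Z))) !comp1m. Qed.

Lemma cospan_op_of X n m p (f : hom X n) (g : hom X m) (j : hom n p) (k : hom m p) :
  is_pushout f g j k -> cospan_of g \o cospan_op f = cospan_op k \o cospan_of j.
Proof. by move=> P; rewrite (csp_comp _ _ P) !compm1 cospan_of_op. Qed.

Lemma cospan_of1 X : cospan_of (idm X) = @idm K X.
Proof. by []. Qed.

Lemma cospan_op1 X : cospan_op (idm X) = @idm K X.
Proof. by []. Qed.

Lemma cospan_of_tens X X' Y Y' (f : hom X X') (g : hom Y Y') :
  cospan_tensm (cospan_of f) (cospan_of g) = cospan_of (f +m g).
Proof. by rewrite csp_tensm coprod_map1. Qed.

Lemma cospan_op_tens X X' Y Y' (f : hom X X') (g : hom Y Y') :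
  cospan_tensm (cospan_op f) (cospan_op g) = cospan_op (f +m g).
Proof. by rewrite csp_tensm coprod_map1. Qed.

Definition cospan_of_iso X Y (i : Iso X Y) : @Iso K X Y.
Proof.
exists (cospan_of i) (cospan_of (iso_inv i));
  abstract (by rewrite -cospan_ofM (iso_invl, iso_invr)).
Defined.

Lemma cospan_of_isoE X Y (i : Iso X Y) : cospan_of i = cospan_op (iso_inv i).
Proof. by apply: (cspI (i := iso_sym i)) => /=; rewrite ?iso_invl ?compm1. Qed.

Lemma cospan_of_invE X Y (i : Iso X Y) : cospan_of (iso_inv i) = cospan_op i.
Proof. exact: (cospan_of_isoE (iso_sym i)). Qed.

Lemma cospan_of_nat X X' Y Y' n m (l : hom X n) (r : hom Y n) (l' : hom X' m)
    (r' : hom Y' m) (i : Iso X X') (j : Iso Y Y') (k : Iso n m) :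
  k \o l = l' \o i -> k \o r = r' \o j ->
  cospan_of j \o csp l r = csp l' r' \o cospan_of i.
Proof.
move=> kl kr; rewrite cospan_of_isoE.
rewrite (csp_comp _ _ (pushout_idr r)) (csp_comp _ _ (pushout_idl l')).
apply: (cspI (i := k)); rewrite ?comp1m ?kl //.
by rewrite compA kr compAr iso_invr compm1.
Qed.

Ltac coprod_tac := rewrite /coprod_map /=;
  repeat (apply: init_uniq || apply: copair_uniq); rewrite ?copairE //.

Local Notation "f ⊗m g" := (cospan_tensm f g) : cat_scope.
Local Notation α := (coprod_assoc S).
Local Notation α' X Y Z := (iso_inv (coprod_assoc S X Y Z)).
Local Notation σ := (coprod_braid S).

Lemma cospan_assoc_nat X X' Y Y' Z Z' (f : @hom K X X') (g : @hom K Y Y')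
    (h : @hom K Z Z') :
  cospan_of (α X' Y' Z') \o ((f ⊗m g) ⊗m h) = (f ⊗m (g ⊗m h)) \o cospan_of (α X Y Z).
Proof.
elim/cspW: f => n fl fr; elim/cspW: g => m gl gr; elim/cspW: h => p hl hr.
rewrite !csp_tensm.
by apply: (cospan_of_nat (k := α n m p)); coprod_tac.
Qed.

Lemma cospan_lunit_nat X X' (f : @hom K X X') :
  cospan_of (coprod_lunit S X') \o (@idm K 0 ⊗m f) = f \o cospan_of (coprod_lunit S X).
Proof.
elim/cspW: f => n l r; rewrite -cospan_of1 csp_tensm.
by apply: (cospan_of_nat (k := coprod_lunit S n)); coprod_tac.
Qed.

Lemma cospan_runit_nat X X' (f : @hom K X X') :
  cospan_of (coprod_runit S X') \o (f ⊗m @idm K 0) = f \o cospan_of (coprod_runit S X).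
Proof.
elim/cspW: f => n l r; rewrite -cospan_of1 csp_tensm.
by apply: (cospan_of_nat (k := coprod_runit S n)); coprod_tac.
Qed.

Lemma cospan_braid_nat X X' Y Y' (f : @hom K X X') (g : @hom K Y Y') :
  cospan_of (σ X' Y') \o (f ⊗m g) = (g ⊗m f) \o cospan_of (σ X Y).
Proof.
elim/cspW: f => n fl fr; elim/cspW: g => m gl gr; rewrite !csp_tensm.
by apply: (cospan_of_nat (k := σ n m)); coprod_tac.
Qed.

Lemma cospan_pentagon W X Y Z :
  ((@idm K W ⊗m cospan_of (α X Y Z)) \o cospan_of (α W (X + Y) Z))
    \o (cospan_of (α W X Y) ⊗m @idm K Z)
  = cospan_of (α W X (Y + Z)) \o cospan_of (α (W + X) Y Z).
Proof.
rewrite -!cospan_of1 !cospan_of_tens -!cospan_ofM; congr cospan_of.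
exact: (pentagon (coprod_monoidal S)).
Qed.

Lemma cospan_triangle X Y :
  (@idm K X ⊗m cospan_of (coprod_lunit S Y)) \o cospan_of (α X 0 Y)
  = cospan_of (coprod_runit S X) ⊗m @idm K Y.
Proof.
rewrite -!cospan_of1 !cospan_of_tens -!cospan_ofM; congr cospan_of.
exact: (triangle (coprod_monoidal S)).
Qed.

Lemma cospan_hexagon1 X Y Z :
  (cospan_of (α Y Z X) \o cospan_of (σ X (Y + Z))) \o cospan_of (α X Y Z)
  = ((@idm K Y ⊗m cospan_of (σ X Z)) \o cospan_of (α Y X Z))
      \o (cospan_of (σ X Y) ⊗m @idm K Z).
Proof.
rewrite -!cospan_of1 !cospan_of_tens -!cospan_ofM; congr cospan_of.
exact: (hexagon1 (coprod_braided S)).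
Qed.

Lemma cospan_hexagon2 X Y Z :
  (cospan_of (α' Z X Y) \o cospan_of (σ (X + Y) Z)) \o cospan_of (α' X Y Z)
  = ((cospan_of (σ X Z) ⊗m @idm K Y) \o cospan_of (α' X Z Y))
      \o (@idm K X ⊗m cospan_of (σ Y Z)).
Proof.
rewrite -!cospan_of1 !cospan_of_tens -!cospan_ofM; congr cospan_of.
exact: (hexagon2 (coprod_braided S)).
Qed.

Lemma cospan_braidK X Y : cospan_of (σ Y X) \o cospan_of (σ X Y) = @idm K (X + Y).
Proof.
rewrite -cospan_ofM -cospan_of1; congr cospan_of.
exact: (braidK (coprod_symmetric S)).
Qed.

Definition cospan_monoidal : Monoidal K :=
  @Build_Monoidal K 0 (coprod S) cospan_tensm cospan_tensm1 cospan_tensmM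
    (fun X Y Z => cospan_of_iso (α X Y Z))
    (fun X => cospan_of_iso (coprod_lunit S X))
    (fun X => cospan_of_iso (coprod_runit S X))
    cospan_assoc_nat cospan_lunit_nat cospan_runit_nat
    cospan_pentagon cospan_triangle.

Definition cospan_braided : Braided K :=
  @Build_Braided K cospan_monoidal (fun X Y => cospan_of_iso (σ X Y))
    cospan_braid_nat cospan_hexagon1 cospan_hexagon2.

Definition cospan_symmetric : Symmetric K :=
  @Build_Symmetric K cospan_braided cospan_braidK.

Lemma pushout_codiag X : is_pushout [idm X, idm X] [idm X, idm X] (idm X) (idm X).
Proof.
apply: is_pushoutI => // t; last by move=> u v; rewrite !compm1.
move=> a b ab; exists a; rewrite compm1; split=> //.
by move: (congr1 (fun h => h \o cinl S) ab); rewrite !copairE.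
Qed.

Lemma pushout_frobenius_l X :
  is_pushout ([idm X, idm X] +m idm X)
    ((idm X +m [idm X, idm X]) \o coprod_assoc S X X X)
    [idm X, idm X] [idm X, idm X].
Proof.
apply: is_pushoutI.
- by coprod_tac.
- move=> t a b ab.
  have e1 : a \o cinl S = b \o cinl S.
    move: (congr1 (fun h => h \o (cinl S \o cinl S)) ab).
    by rewrite /coprod_map /= !copairE.
  have e2 : a \o cinl S = b \o cinr S.
    move: (congr1 (fun h => h \o (cinl S \o cinr S)) ab).
    by rewrite /coprod_map /= !copairE.
  have e3 : a \o cinr S = b \o cinr S.
    move: (congr1 (fun h => h \o cinr S) ab).
    by rewrite /coprod_map /= !copairE.
  exists (a \o cinl S); split; apply: copair_uniq;
    by rewrite !copairE // ?e1 ?e2 ?e3 -?e2 ?e1.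
- move=> t u v /(congr1 (fun h => h \o cinl S)).
  by rewrite !copairE.
Qed.

Lemma pushout_frobenius_r X :
  is_pushout (idm X +m [idm X, idm X])
    (([idm X, idm X] +m idm X) \o iso_inv (coprod_assoc S X X X))
    [idm X, idm X] [idm X, idm X].
Proof.
apply: is_pushoutI.
- by coprod_tac.
- move=> t a b ab.
  have e1 : a \o cinl S = b \o cinl S.
    move: (congr1 (fun h => h \o cinl S) ab).
    by rewrite /coprod_map /= !copairE.
  have e2 : a \o cinr S = b \o cinl S.
    move: (congr1 (fun h => h \o (cinr S \o cinl S)) ab).
    by rewrite /coprod_map /= !copairE.
  have e3 : a \o cinr S = b \o cinr S.
    move: (congr1 (fun h => h \o (cinr S \o cinr S)) ab).
    by rewrite /coprod_map /= !copairE.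
  exists (a \o cinl S); split; apply: copair_uniq;
    by rewrite !copairE // ?e1 -?e2 ?e3.
- move=> t u v /(congr1 (fun h => h \o cinl S)).
  by rewrite !copairE.
Qed.

Local Notation "∇ X" := [idm X, idm X] (at level 8, X at level 8).
Local Notation μ X := (cospan_of ∇ X).
Local Notation δ X := (cospan_op ∇ X).
Local Notation η X := (cospan_of (init_map S X)).
Local Notation ε X := (cospan_op (init_map S X)).

Lemma cospan_mu_assoc X :
  μ X \o (μ X ⊗m @idm K X) = μ X \o (@idm K X ⊗m μ X) \o cospan_of (α X X X).
Proof.
rewrite -!cospan_of1 !cospan_of_tens -!cospan_ofM.
by congr cospan_of; coprod_tac.
Qed.

Lemma cospan_mu_unitl X : μ X \o (η X ⊗m @idm K X) = cospan_of (coprod_lunit S X).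
Proof.
rewrite -!cospan_of1 !cospan_of_tens -!cospan_ofM.
by congr cospan_of; coprod_tac.
Qed.

Lemma cospan_mu_unitr X : μ X \o (@idm K X ⊗m η X) = cospan_of (coprod_runit S X).
Proof.
rewrite -!cospan_of1 !cospan_of_tens -!cospan_ofM.
by congr cospan_of; coprod_tac.
Qed.

Lemma cospan_mu_comm X : μ X \o cospan_of (σ X X) = μ X.
Proof. by rewrite -!cospan_ofM; congr cospan_of; coprod_tac. Qed.

Lemma cospan_delta_assoc X :
  cospan_of (α X X X) \o (δ X ⊗m @idm K X) \o δ X = (@idm K X ⊗m δ X) \o δ X.
Proof.
rewrite cospan_of_isoE -!cospan_op1 !cospan_op_tens -!cospan_opM.
by congr cospan_op; coprod_tac.
Qed.

Lemma cospan_delta_unitl X :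
  (ε X ⊗m @idm K X) \o δ X = cospan_of (iso_inv (coprod_lunit S X)).
Proof.
rewrite cospan_of_invE -!cospan_op1 !cospan_op_tens -!cospan_opM.
by congr cospan_op; coprod_tac.
Qed.

Lemma cospan_delta_unitr X :
  (@idm K X ⊗m ε X) \o δ X = cospan_of (iso_inv (coprod_runit S X)).
Proof.
rewrite cospan_of_invE -!cospan_op1 !cospan_op_tens -!cospan_opM.
by congr cospan_op; coprod_tac.
Qed.

Lemma cospan_delta_comm X : cospan_of (σ X X) \o δ X = δ X.
Proof.
by rewrite cospan_of_isoE -!cospan_opM; congr cospan_op; coprod_tac.
Qed.

Lemma cospan_frobenius_l X :
  (@idm K X ⊗m μ X) \o cospan_of (α X X X) \o (δ X ⊗m @idm K X) = δ X \o μ X.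
Proof.
rewrite -{1}cospan_of1 -cospan_op1 cospan_of_tens cospan_op_tens -cospan_ofM.
exact: (cospan_op_of (pushout_frobenius_l X)).
Qed.

Lemma cospan_frobenius_r X :
  (μ X ⊗m @idm K X) \o cospan_of (α' X X X) \o (@idm K X ⊗m δ X) = δ X \o μ X.
Proof.
rewrite -{1}cospan_of1 -cospan_op1 cospan_of_tens cospan_op_tens -cospan_ofM.
exact: (cospan_op_of (pushout_frobenius_r X)).
Qed.

Lemma cospan_special X : μ X \o δ X = @idm K X.
Proof. by rewrite (cospan_op_of (pushout_codiag X)) -cospan_ofM compm1. Qed.

Definition cospan_frob (X : C) : @SCFMonoid K cospan_symmetric X :=
  @Build_SCFMonoid K cospan_symmetric X (μ X) (η X) (δ X) (ε X)
    (cospan_mu_assoc X) (cospan_mu_unitl X) (cospan_mu_unitr X)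
    (cospan_mu_comm X) (cospan_delta_assoc X) (cospan_delta_unitl X)
    (cospan_delta_unitr X) (cospan_delta_comm X) (cospan_frobenius_l X)
    (cospan_frobenius_r X) (cospan_special X).

Definition coprod_interchange W X Y Z : Iso ((W + X) + (Y + Z)) ((W + Y) + (X + Z)).
Proof.
exists [cinl S +m cinl S, cinr S +m cinr S] [cinl S +m cinl S, cinr S +m cinr S];
  abstract (by coprod_tac).
Defined.

Lemma cospan_interchange W X Y Z :
  @interchange K cospan_symmetric W X Y Z = cospan_of (coprod_interchange W X Y Z).
Proof.
transitivity (cospan_of (α' W Y (X + Z)) \o
  (@idm K W ⊗m (cospan_of (α Y X Z) \o (cospan_of (σ X Y) ⊗m @idm K Z)
                  \o cospan_of (α' X Y Z)))
  \o cospan_of (α W X (Y + Z))); first by [].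
rewrite -!cospan_of1 cospan_of_tens -!cospan_ofM cospan_of_tens -!cospan_ofM.
by congr cospan_of; coprod_tac.
Qed.

Lemma cospan_mu_tens X Y :
  μ (X + Y) = (μ X ⊗m μ Y) \o @interchange K cospan_symmetric X Y X Y.
Proof.
rewrite cospan_interchange cospan_of_tens -cospan_ofM.
by congr cospan_of; coprod_tac.
Qed.

Lemma cospan_eta_tens X Y :
  η (X + Y) = (η X ⊗m η Y) \o cospan_of (iso_inv (coprod_lunit S 0)).
Proof. by rewrite cospan_of_tens -cospan_ofM; congr cospan_of; coprod_tac. Qed.

Lemma cospan_delta_tens X Y :
  δ (X + Y) = @interchange K cospan_symmetric X X Y Y \o (δ X ⊗m δ Y).
Proof.
rewrite cospan_interchange cospan_of_isoE cospan_op_tens -cospan_opM.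
by congr cospan_op; coprod_tac.
Qed.

Lemma cospan_eps_tens X Y :
  ε (X + Y) = cospan_of (coprod_lunit S 0) \o (ε X ⊗m ε Y).
Proof.
rewrite cospan_of_isoE cospan_op_tens -cospan_opM.
by congr cospan_op; coprod_tac.
Qed.

Definition cospan_hypergraph : Hypergraph K :=
  @Build_Hypergraph K cospan_symmetric cospan_frob
    cospan_mu_tens cospan_eta_tens cospan_delta_tens cospan_eps_tens.

End CospanHypergraph.

Section UnitCoherence.
Variables (C : Category) (M : Monoidal C).
Local Notation "1" := (munit M).
Local Notation "x ⊗ y" := (tens M x y) : cat_scope.
Local Notation "f ⊗m g" := (tensm M f g) : cat_scope.

Lemma tens1_inj (x y : C) (f g : hom x y) :
  idm 1 ⊗m f = idm 1 ⊗m g -> f = g.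
Proof. by move=> e; apply: (iso_epi (i := lunit M x)); rewrite -!lunit_nat e. Qed.

Lemma tensr1_inj (x y : C) (f g : hom x y) :
  f ⊗m idm 1 = g ⊗m idm 1 -> f = g.
Proof. by move=> e; apply: (iso_epi (i := runit M x)); rewrite -!runit_nat e. Qed.

Lemma tensm_compl (x y z w : C) (g : hom y z) (f : hom x y) :
  idm w ⊗m (g \o f) = (idm w ⊗m g) \o (idm w ⊗m f).
Proof. by rewrite -tensmM comp1m. Qed.

Lemma tensm_compr (x y z w : C) (g : hom y z) (f : hom x y) :
  (g \o f) ⊗m idm w = (g ⊗m idm w) \o (f ⊗m idm w).
Proof. by rewrite -tensmM comp1m. Qed.

Definition tens_iso (x x' y y' : C) (i : Iso x x') (j : Iso y y') :
  Iso (x ⊗ y) (x' ⊗ y').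
Proof.
exists (i ⊗m j) (iso_inv i ⊗m iso_inv j).
- abstract (by rewrite -tensmM !iso_invl tensm1).
- abstract (by rewrite -tensmM !iso_invr tensm1).
Defined.

Lemma lunit_assoc (x y : C) : lunit M (x ⊗ y) \o assoc M 1 x y = lunit M x ⊗m idm y.
Proof.
apply: tens1_inj; rewrite tensm_compl.
apply: (iso_epi (i := assoc M 1 (1 ⊗ x) y)).
apply: (iso_epi (i := tens_iso (assoc M 1 1 x) (iso_id y))) => /=.
have -> : (idm 1 ⊗m lunit M (x ⊗ y)) \o (idm 1 ⊗m assoc M 1 x y)
            \o assoc M 1 (1 ⊗ x) y \o (assoc M 1 1 x ⊗m idm y)
          = assoc M 1 x y \o ((runit M 1 ⊗m idm x) ⊗m idm y).
  rewrite 2!compAr (compA (idm 1 ⊗m assoc M 1 x y)) pentagon compA triangle.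
  by rewrite assoc_nat tensm1.
by rewrite -triangle tensm_compr compA assoc_nat.
Qed.

Lemma lunit1_runit1 : lunit M 1 = runit M 1 :> hom _ _.
Proof.
apply: tensr1_inj; rewrite -lunit_assoc -triangle; congr (_ \o _).
by apply: (iso_mono (i := lunit M 1)); rewrite lunit_nat.
Qed.

End UnitCoherence.

Section DecoratedCospan.
Variables (C : Category) (S : Coproducts C) (hC : has_finite_colimits C)
  (D : Category) (N : Braided D) (F : LaxBraidedFunctor (coprod_braided S) N).
Implicit Types X Y Z W : C.

Record dcospan X Y := {
  dcosp :> cospan X Y;
  decor : hom (munit N) (F (apex dcosp)) }.

Definition dcospan_morphism X Y (c d : dcospan X Y) (n : hom (apex c) (apex d)) :=
  cospan_morphism n /\ fmap F n \o decor c = decor d.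

Definition dcospan_iso X Y (c d : dcospan X Y) :=
  exists (n : hom (apex c) (apex d)) (n' : hom (apex d) (apex c)),
    [/\ dcospan_morphism n, dcospan_morphism n', n' \o n = idm _ & n \o n' = idm _].

Lemma dcospan_isoP X Y (c d : dcospan X Y) :
  dcospan_iso c d <-> exists n : Iso (apex c) (apex d), dcospan_morphism n.
Proof.
split=> [[n [n' [nP _ nl nr]]]|[n [[nl nr] ns]]].
  by exists (Build_Iso nl nr).
exists n, (iso_inv n); split=> //; rewrite ?iso_invl ?iso_invr //.
split; first by split; rewrite -?nl -?nr compA iso_invl comp1m.
by rewrite -ns compA -fmapM iso_invl fmap1 comp1m.
Qed.

Lemma dcospan_iso_refl X Y (c : dcospan X Y) : dcospan_iso c c.
Proof.
apply/dcospan_isoP; exists (iso_id _).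
by split; [split|]; rewrite /= ?fmap1 comp1m.
Qed.

Lemma dcospan_iso_sym X Y (c d : dcospan X Y) : dcospan_iso c d -> dcospan_iso d c.
Proof. by move=> [n [n' [? ? ? ?]]]; exists n', n. Qed.

Lemma dcospan_iso_trans X Y (c d e : dcospan X Y) :
  dcospan_iso c d -> dcospan_iso d e -> dcospan_iso c e.
Proof.
move=> /dcospan_isoP[n [[nl nr] ns]] /dcospan_isoP[m [[ml mr] ms]].
apply/dcospan_isoP; exists (iso_comp m n); split; [split|]; rewrite /=.
- by rewrite compAr nl ml.
- by rewrite compAr nr mr.
- by rewrite fmapM compAr ns ms.
Qed.

Definition dcospan_class X Y : Type :=
  classes (@dcospan_iso_refl X Y) (@dcospan_iso_sym X Y) (@dcospan_iso_trans X Y).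

Definition dcospan_cls X Y (c : dcospan X Y) : dcospan_class X Y := cls _ _ _ c.

Lemma dcospan_cls_eq X Y (c d : dcospan X Y) :
  dcospan_cls c = dcospan_cls d <-> dcospan_iso c d.
Proof. exact: cls_eq. Qed.

Definition decor_tens (n m : C) (s : hom (munit N) (F n)) (t : hom (munit N) (F m)) :
    hom (munit N) (F (coprod S n m)) :=
  lax2 F n m \o tensm N s t \o iso_inv (lunit N (munit N)).

Definition dcospan_comp X Y Z (a : dcospan X Y) (b : dcospan Y Z) : dcospan X Z :=
  let p := choose_pushout (rleg a) (lleg b) hC in
  {| dcosp := Build_cospan (po_tip p) (po_inl p \o lleg a) (po_inr p \o rleg b);
     decor := fmap F (copair S (po_inl p) (po_inr p))
                \o decor_tens (decor a) (decor b) |}.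

Definition dcospan_idm X : dcospan_class X X :=
  dcospan_cls {| dcosp := Build_cospan X (idm X) (idm X);
                 decor := fmap F (init_map S X) \o lax0 F |}.

Definition dcospan_class_comp X Y Z (g : dcospan_class Y Z) (f : dcospan_class X Y) :
    dcospan_class X Z :=
  dcospan_cls (dcospan_comp (cls_repr f) (cls_repr g)).

Lemma fmapMA (x y z : C) w (g : hom y z) (f : hom x y) (h : hom w (F x)) :
  fmap F g \o (fmap F f \o h) = fmap F (g \o f) \o h.
Proof. by rewrite fmapM compA. Qed.

Lemma decor_tens_nat (n n' m m' : C) (f : hom n n') (g : hom m m')
    (s : hom (munit N) (F n)) (t : hom (munit N) (F m)) :
  decor_tens (fmap F f \o s) (fmap F g \o t)
  = fmap F (coprod_map S f g) \o decor_tens s t.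
Proof.
rewrite /decor_tens tensmM !compA.
by have /= -> := lax2_nat F f g.
Qed.

Lemma decor_tens_natl (n n' m : C) (f : hom n n')
    (s : hom (munit N) (F n)) (t : hom (munit N) (F m)) :
  decor_tens (fmap F f \o s) t
  = fmap F (coprod_map S f (idm m)) \o decor_tens s t.
Proof. by rewrite -decor_tens_nat fmap1 comp1m. Qed.

Lemma decor_tens_natr (n m m' : C) (g : hom m m')
    (s : hom (munit N) (F n)) (t : hom (munit N) (F m)) :
  decor_tens s (fmap F g \o t)
  = fmap F (coprod_map S (idm n) g) \o decor_tens s t.
Proof. by rewrite -decor_tens_nat fmap1 comp1m. Qed.

Lemma decor_tensA (n m l : C) (s : hom (munit N) (F n)) (t : hom (munit N) (F m))
    (u : hom (munit N) (F l)) :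
  fmap F (coprod_assoc S n m l) \o decor_tens (decor_tens s t) u
  = decor_tens s (decor_tens t u).
Proof.
rewrite /decor_tens; set I := munit N; set li := iso_inv (lunit N I).
have -> : tensm N (lax2 F n m \o tensm N s t \o li) u
  = tensm N (lax2 F n m) (idm _) \o tensm N (tensm N s t) u \o tensm N li (idm I).
  by rewrite -!tensmM comp1m compm1.
have -> : tensm N s (lax2 F m l \o tensm N t u \o li)
  = tensm N (idm _) (lax2 F m l) \o tensm N s (tensm N t u) \o tensm N (idm I) li.
  by rewrite -!tensmM comp1m compm1.
have <- : assoc N I I I \o tensm N li (idm I) = tensm N (idm I) li.
  apply: (iso_epi (i := tens_iso N (lunit N I) (iso_id I))) => /=.
  rewrite compAr -tensmM iso_invl comp1m tensm1 compm1 lunit1_runit1 -triangle.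
  by rewrite compA -tensm_compl iso_invl tensm1 comp1m.
rewrite !compA; have /= -> := lax_assoc F n m l.
by rewrite (whisker _ (assoc_nat N s t u)) compA.
Qed.

Lemma decor_tens_lunit (n : C) (s : hom (munit N) (F n)) :
  fmap F (coprod_lunit S n) \o decor_tens (lax0 F) s = s.
Proof.
rewrite /decor_tens -[lax0 F]compm1 -[s in tensm _ _ s]comp1m tensmM !compA.
have /= -> := lax_lunit F n.
by rewrite lunit_nat compAr iso_invr compm1.
Qed.

Lemma decor_tens_runit (n : C) (s : hom (munit N) (F n)) :
  fmap F (coprod_runit S n) \o decor_tens s (lax0 F) = s.
Proof.
rewrite /decor_tens -[lax0 F]compm1 -[s in tensm _ s _]comp1m tensmM !compA.
have /= -> := lax_runit F n.
by rewrite runit_nat -lunit1_runit1 compAr iso_invr compm1.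
Qed.

(** The composite may be computed with any representatives and any pushout. *)
Lemma dcospan_comp_cls X Y Z n m p (al : hom X n) (ar : hom Y n) (bl : hom Y m)
    (br : hom Z m) (s : hom (munit N) (F n)) (t : hom (munit N) (F m))
    (j : hom n p) (k : hom m p) :
  is_pushout ar bl j k ->
  dcospan_class_comp
    (dcospan_cls {| dcosp := Build_cospan m bl br; decor := t |})
    (dcospan_cls {| dcosp := Build_cospan n al ar; decor := s |})
  = dcospan_cls {| dcosp := Build_cospan p (j \o al) (k \o br);
                   decor := fmap F (copair S j k) \o decor_tens s t |}.
Proof.
set a := Build_dcospan (dcosp := Build_cospan n al ar) s.
set b := Build_dcospan (dcosp := Build_cospan m bl br) t.
move=> P; rewrite /dcospan_class_comp /dcospan_comp.
have /dcospan_isoP[u [[ul ur] us]] : dcospan_iso (cls_repr (dcospan_cls a)) a.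
  exact: cls_repr_rel.
have /dcospan_isoP[v [[vl vr] vt]] : dcospan_iso (cls_repr (dcospan_cls b)) b.
  exact: cls_repr_rel.
set q := choose_pushout _ _ _.
have [w [wj wk]] := pushout_iso (po_is_pushout q) P ur vl.
apply/dcospan_cls_eq/dcospan_isoP; exists w; split; first split => /=.
- by rewrite compA wj compAr ul.
- by rewrite compA wk compAr vr.
rewrite /= in us vt *; rewrite -us -vt decor_tens_nat.
rewrite !fmapMA comp_copair copair_map.
by rewrite wj wk.
Qed.

Lemma dcospan_clsW X Y (P : dcospan_class X Y -> Prop) :
  (forall n l r (s : hom (munit N) (F n)), P (dcospan_cls 
     {| dcosp := Build_cospan n l r; decor := s |})) ->
  forall f, P f.
Proof. by move=> H f; rewrite -(cls_reprK f); case: (cls_repr f) => -[]. Qed.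

Lemma dcospan_cls_congr X Y n (l l' : hom X n) (r r' : hom Y n)
    (s s' : hom (munit N) (F n)) : l = l' -> r = r' -> s = s' ->
  dcospan_cls {| dcosp := Build_cospan n l r; decor := s |}
  = dcospan_cls {| dcosp := Build_cospan n l' r'; decor := s' |}.
Proof. by move=> -> -> ->. Qed.

Lemma dcospan_class_compA W X Y Z (h : dcospan_class Y Z) (g : dcospan_class X Y)
    (f : dcospan_class W X) :
  dcospan_class_comp h (dcospan_class_comp g f)
  = dcospan_class_comp (dcospan_class_comp h g) f.
Proof.
elim/dcospan_clsW: f => n fl fr s; elim/dcospan_clsW: g => m gl gr t.
elim/dcospan_clsW: h => l hl hr u.
pose p := choose_pushout fr gl hC; pose q := choose_pushout gr hl hC.
pose r := choose_pushout (po_inr p \o gr) hl hC.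
have [v [v1 v2 V]] :=
  pushout_paste (po_is_pushout p) (po_is_pushout q) (po_is_pushout r).
rewrite (dcospan_comp_cls _ _ _ _ (po_is_pushout p)).
rewrite (dcospan_comp_cls _ _ _ _ (po_is_pushout r)).
rewrite (dcospan_comp_cls _ _ _ _ (po_is_pushout q)).
rewrite (dcospan_comp_cls _ _ _ _ V).
apply: dcospan_cls_congr; first by rewrite compA.
  by rewrite compA v2.
rewrite decor_tens_natl decor_tens_natr -decor_tensA.
rewrite !fmapMA; congr (fmap F _ \o _).
rewrite !copair_map comp_copair /=.
by apply: copair_uniq; [apply: copair_uniq|];
   rewrite !copairE // -?v1 -?v2 ?copairE.
Qed.

Lemma dcospan_class_comp1m X Y (f : dcospan_class X Y) :
  dcospan_class_comp (dcospan_idm Y) f = f.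
Proof.
elim/dcospan_clsW: f => n l r s.
rewrite (dcospan_comp_cls _ _ _ _ (pushout_idr r)).
apply: dcospan_cls_congr; rewrite ?comp1m ?compm1 //.
rewrite decor_tens_natr fmapMA copair_map compm1.
rewrite -[RHS](decor_tens_runit s) /=.
by congr (fmap F (copair S _ _) \o _); apply: init_uniq.
Qed.

Lemma dcospan_class_compm1 X Y (f : dcospan_class X Y) :
  dcospan_class_comp f (dcospan_idm X) = f.
Proof.
elim/dcospan_clsW: f => n l r s.
rewrite (dcospan_comp_cls _ _ _ _ (pushout_idl l)).
apply: dcospan_cls_congr; rewrite ?comp1m ?compm1 //.
rewrite decor_tens_natl fmapMA copair_map compm1.
rewrite -[RHS](decor_tens_lunit s) /=.
by congr (fmap F (copair S _ _) \o _); apply: init_uniq.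
Qed.

Definition FCospan : Category := {|
  ob := ob C;
  hom := dcospan_class;
  idm := dcospan_idm;
  comp := dcospan_class_comp;
  compA := dcospan_class_compA;
  comp1m := dcospan_class_comp1m;
  compm1 := dcospan_class_compm1 |}.

End DecoratedCospan.

(* Main.v *)
From mathcomp Require Import all_boot.
Require Import Defs.

(** A decoration of [n] is an element of [Hom(1, F n)], and [n |-> Hom(1, F n)]
    is itself a lax monoidal functor, from [(C, +)] to sets. It is symmetric
    although [D] is only braided, because the only braiding of [D] that moves
    decorations past each other is the one of the unit with itself, and that one
    is the identity ([braid_unit]). Two consequences carry the proof.

    - Decorations may be summed: [decor_tens s t] is associative, unital and
      commutative up to the coherence maps of [C], hence compatible with the
      middle-four interchange ([decor_tens_interchange]). So the coproduct of
      decorated cospans is a bifunctor ([dcospan_tensmM]).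

    - Every object carries an initial decoration [1 -> F 0 -> F n], which every
      map of [C] preserves and every sum preserves. Giving each cospan its
      initial decoration is therefore functorial ([decorateM]) and compatible
      with sums ([decorate_tens]).

    The structure maps of the hypergraph category of decorated cospans are the
    images of those of [Cospan C]. Each coherence or Frobenius equation between
    them is then the image of the same equation in [Cospan C]. What remains is
    the naturality of the associator, unitors and braiding at arbitrary
    decorations, which is how they act on sums of decorations.
    With these choices the functor [Cospan C -> FCospan] is the identity on
    objects and strictly monoidal, and it is faithful because an isomorphism of
    decorated cospans is in particular an isomorphism of cospans. *)

Set Implicit Arguments.
Unset Strict Implicit.
Unset Printing Implicit Defensive.

Local Open Scope cat_scope.

(** * The braiding of the unit *)

Section BraidingUnit.
Variables (D : Category) (N : Braided D).
Local Notation "1" := (munit N).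

(** The hexagon at [x, 1, 1] becomes the tensor of this equation with the unit,
    once its unitors are absorbed and [braid N x 1] is cancelled on the left. *)
Lemma lunit_braid (x : D) : lunit N x \o braid N x 1 = runit N x.
Proof.
apply: (@tensr1_inj D N); apply: (iso_mono (i := braid N x 1)).
rewrite tensm_compr -triangle -lunit_assoc.
have H := congr1 (fun h => lunit N (tens N 1 x) \o h) (hexagon1 N x 1 1).
by rewrite /= !compA lunit_assoc lunit_nat -braid_nat !compAr in H *.
Qed.

Lemma braid_unit : braid N 1 1 = idm _ :> hom _ _.
Proof.
by apply: (iso_mono (i := lunit N 1)); rewrite lunit_braid compm1 lunit1_runit1.
Qed.

End BraidingUnit.

Ltac coprod_tac := rewrite /coprod_map /=;
  repeat (apply: init_uniq || apply: copair_uniq); rewrite ?copairE //.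

Section DecoratedCospanHypergraph.
Variables (C : Category) (S : Coproducts C) (hC : has_finite_colimits C)
  (D : Category) (N : Braided D) (F : LaxBraidedFunctor (coprod_braided S) N).
Implicit Types X Y Z W n m : C.

Local Notation K := (Cospan hC).
Local Notation FK := (FCospan hC F).
Local Notation "x + y" := (coprod S x y).
Local Notation "f +m g" := (coprod_map S f g) (at level 40, left associativity).
Local Notation "[ f , g ]" := (copair S f g).
Local Notation "0" := (init S).
Local Notation decoration n := (hom (munit N) (F n)).

(** * Sums of decorations and initial decorations *)

(** Moving [t] past [s] braids the two copies of the unit that are their
    domains. *)
Lemma decor_tens_braid n m (s : decoration n) (t : decoration m) :
  fmap F (coprod_braid S n m) \o decor_tens s t = decor_tens t s.
Proof.
rewrite /decor_tens !compA; have /= -> := lax_braid F n m.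
by rewrite (whisker _ (braid_nat N s t)) braid_unit compm1.
Qed.

Lemma decor_tensA_inv n m l (s : decoration n) (t : decoration m)
    (u : decoration l) :
  fmap F (iso_inv (coprod_assoc S n m l)) \o decor_tens s (decor_tens t u)
  = decor_tens (decor_tens s t) u.
Proof. by rewrite -decor_tensA fmapMA iso_invl fmap1 comp1m. Qed.

Lemma decor_tens_interchange n m n' m' (s : decoration n) (t : decoration m)
    (s' : decoration n') (t' : decoration m') :
  fmap F (coprod_interchange S n m n' m')
    \o decor_tens (decor_tens s t) (decor_tens s' t')
  = decor_tens (decor_tens s s') (decor_tens t t').
Proof.
rewrite -(decor_tensA_inv s) -(decor_tensA_inv s s') -(decor_tensA t s' t').
(* Both sides become images of the sum of [s] with that of [t], [s'] and [t'],
   the right one by a braiding of [t] past [s']. *)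
rewrite -(decor_tensA s' t t') -(decor_tens_braid t s') decor_tens_natl.
rewrite !(decor_tens_natr _ s) !fmapMA; congr (fmap F _ \o _).
by coprod_tac.
Qed.

Definition decor0 n : decoration n := fmap F (init_map S n) \o lax0 F.

Lemma decor0_nat n m (f : hom n m) : fmap F f \o decor0 n = decor0 m.
Proof. by rewrite fmapMA; congr (fmap F _ \o _); apply: init_uniq. Qed.

Lemma decor_tens0 n m : decor_tens (decor0 n) (decor0 m) = decor0 (n + m).
Proof.
rewrite decor_tens_nat -[decor_tens _ _]comp1m -(fmap1 F).
rewrite -(iso_invl (coprod_lunit S 0)) fmapM compAr decor_tens_lunit !fmapMA.
by congr (fmap F _ \o _); apply: init_uniq.
Qed.

Lemma decor_tens0r n m (s : decoration n) :
  decor_tens s (decor0 m) = fmap F (cinl S) \o s.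
Proof.
rewrite -[in RHS](decor_tens_runit s) decor_tens_natr fmapMA.
by congr (fmap F _ \o _); coprod_tac.
Qed.

Lemma decor_tens0l n m (t : decoration m) :
  decor_tens (decor0 n) t = fmap F (cinr S) \o t.
Proof.
rewrite -[in RHS](decor_tens_lunit t) decor_tens_natl fmapMA.
by congr (fmap F _ \o _); coprod_tac.
Qed.

(** * The tensor product of decorated cospans *)

Definition dcsp X Y n (l : hom X n) (r : hom Y n) (s : decoration n) :
    @hom FK X Y :=
  dcospan_cls {| dcosp := Build_cospan n l r; decor := s |}.

Lemma dcspW X Y (P : @hom FK X Y -> Prop) :
  (forall n (l : hom X n) (r : hom Y n) s, P (dcsp l r s)) -> forall f, P f.
Proof. exact: dcospan_clsW. Qed.

Lemma dcspI X Y n m (l : hom X n) (r : hom Y n) (l' : hom X m) (r' : hom Y m)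
    (s : decoration n) (s' : decoration m) (i : Iso n m) :
  i \o l = l' -> i \o r = r' -> fmap F i \o s = s' ->
  dcsp l r s = dcsp l' r' s'.
Proof. by move=> *; apply/dcospan_cls_eq/dcospan_isoP; exists i. Qed.

Lemma dcsp_comp X Y Z n m p (al : hom X n) (ar : hom Y n) (bl : hom Y m)
    (br : hom Z m) (s : decoration n) (t : decoration m)
    (j : hom n p) (k : hom m p) :
  is_pushout ar bl j k ->
  dcsp bl br t \o dcsp al ar s
  = dcsp (j \o al) (k \o br) (fmap F [j, k] \o decor_tens s t).
Proof. exact: dcospan_comp_cls. Qed.

Definition dcospan_sum X X' Y Y' (c : dcospan F X X') (d : dcospan F Y Y') :
    dcospan F (X + Y) (X' + Y') :=
  {| dcosp := cospan_sum S c d; decor := decor_tens (decor c) (decor d) |}.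

Definition dcospan_tensm X X' Y Y' (f : @hom FK X X') (g : @hom FK Y Y') :
    @hom FK (X + Y) (X' + Y') :=
  dcospan_cls (dcospan_sum (cls_repr f) (cls_repr g)).

Local Notation "f ⊗m g" := (dcospan_tensm f g) : cat_scope.

Lemma dcsp_tensm X X' Y Y' n m (l : hom X n) (r : hom X' n) (l' : hom Y m)
    (r' : hom Y' m) (s : decoration n) (t : decoration m) :
  dcsp l r s ⊗m dcsp l' r' t = dcsp (l +m l') (r +m r') (decor_tens s t).
Proof.
rewrite /dcospan_tensm /dcospan_sum /cospan_sum /dcsp.
set c := Build_dcospan (dcosp := Build_cospan n l r) s.
set d := Build_dcospan (dcosp := Build_cospan m l' r') t.
have /dcospan_isoP[i [[il ir] si]] : dcospan_iso (cls_repr (dcospan_cls c)) c.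
  exact: cls_repr_rel.
have /dcospan_isoP[j [[jl jr] tj]] : dcospan_iso (cls_repr (dcospan_cls d)) d.
  exact: cls_repr_rel.
apply/dcospan_cls_eq/dcospan_isoP; exists (coprod_iso S i j).
split; first by split; rewrite /= -coprod_mapM ?(il, ir) ?(jl, jr).
by rewrite /= in si tj *; rewrite -decor_tens_nat si tj.
Qed.

Lemma dcospan_tensm1 X Y : @idm FK X ⊗m @idm FK Y = @idm FK (X + Y).
Proof. by rewrite [LHS]dcsp_tensm !coprod_map1 [decor_tens _ _]decor_tens0. Qed.

(** The sum of two pushouts is a pushout, and the two decorations of the
    composite differ by the interchange of their four summands. *)
Lemma dcospan_tensmM X X' X'' Y Y' Y'' (f' : @hom FK X' X'') (f : @hom FK X X')
    (g' : @hom FK Y' Y'') (g : @hom FK Y Y') :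
  (f' \o f) ⊗m (g' \o g) = (f' ⊗m g') \o (f ⊗m g).
Proof.
elim/dcspW: f => n fl fr s; elim/dcspW: f' => n' fl' fr' s'.
elim/dcspW: g => m gl gr t; elim/dcspW: g' => m' gl' gr' t'.
have P := po_is_pushout (choose_pushout fr fl' hC).
have Q := po_is_pushout (choose_pushout gr gl' hC).
rewrite (dcsp_comp _ _ _ _ P) (dcsp_comp _ _ _ _ Q) !dcsp_tensm.
rewrite (dcsp_comp _ _ _ _ (pushout_coprod S P Q)) !coprod_mapM.
rewrite decor_tens_nat -decor_tens_interchange fmapMA.
by congr (dcsp _ _ (fmap F _ \o _)); coprod_tac.
Qed.

(** * Cospans as decorated cospans *)

Definition decorate X Y (f : @hom K X Y) : @hom FK X Y :=
  dcospan_cls {| dcosp := cls_repr f; decor := decor0 _ |}.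

Lemma decorate_csp X Y n (l : hom X n) (r : hom Y n) :
  decorate (csp hC l r) = dcsp l r (decor0 n).
Proof.
rewrite /decorate /csp; set c := Build_cospan n l r.
have /cospan_isoP[i [il ir]] : cospan_iso (cls_repr (cospan_cls c)) c.
  exact: cls_repr_rel.
apply/dcospan_cls_eq/dcospan_isoP; exists i.
by split; last exact: decor0_nat.
Qed.

Lemma decorate1 X : decorate (@idm K X) = @idm FK X.
Proof. exact: decorate_csp. Qed.

Lemma decorateM X Y Z (g : @hom K Y Z) (f : @hom K X Y) :
  decorate (g \o f) = decorate g \o decorate f.
Proof.
elim/(@cspW C hC): f => n fl fr; elim/(@cspW C hC): g => m gl gr.
have P := po_is_pushout (choose_pushout fr gl hC).
rewrite (csp_comp _ _ _ P) !decorate_csp (dcsp_comp _ _ _ _ P).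
by rewrite decor_tens0 decor0_nat.
Qed.

Lemma decorate_tens X X' Y Y' (f : @hom K X X') (g : @hom K Y Y') :
  decorate (cospan_tensm S f g) = decorate f ⊗m decorate g.
Proof.
elim/(@cspW C hC): f => n fl fr; elim/(@cspW C hC): g => m gl gr.
by rewrite csp_tensm !decorate_csp dcsp_tensm decor_tens0.
Qed.

Lemma decorate_inj X Y : injective (@decorate X Y).
Proof.
move=> f g; elim/(@cspW C hC): f => n fl fr; elim/(@cspW C hC): g => m gl gr.
rewrite !decorate_csp => /dcospan_cls_eq/dcospan_isoP[i [[il ir] _]].
exact: cspI il ir.
Qed.

Definition decorate_iso X Y (i : @Iso K X Y) : @Iso FK X Y.
Proof.
exists (decorate i) (decorate (iso_inv i));
  abstract (by rewrite -decorateM (iso_invl, iso_invr) decorate1).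
Defined.

Definition decorate_functor : Functor K FK :=
  @Build_Functor K FK id decorate decorate1 decorateM.

(** * The symmetric monoidal structure *)

(** Composing with an undecorated isomorphism only changes a leg, because the
    initial decoration is neutral for sums. *)
Lemma decorate_nat X X' Y Y' n m (l : hom X n) (r : hom Y n) (l' : hom X' m)
    (r' : hom Y' m) (s : decoration n) (s' : decoration m)
    (i : Iso X X') (j : Iso Y Y') (k : Iso n m) :
  k \o l = l' \o i -> k \o r = r' \o j -> fmap F k \o s = s' ->
  decorate (cospan_of hC j) \o dcsp l r s
  = dcsp l' r' s' \o decorate (cospan_of hC i).
Proof.
move=> kl kr ks; rewrite cospan_of_isoE !decorate_csp.
rewrite (dcsp_comp _ _ _ _ (pushout_idr r)) (dcsp_comp _ _ _ _ (pushout_idl l')).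
rewrite decor_tens0r decor_tens0l !fmapMA copair_inl copair_inr !fmap1.
apply: (dcspI (i := k)); rewrite ?comp1m ?kl //.
by rewrite compA kr compAr iso_invr compm1.
Qed.

Local Notation α := (coprod_assoc S).
Local Notation σ := (coprod_braid S).
Local Notation dec f := (decorate (cospan_of hC f)).

Lemma dcospan_assoc_nat X X' Y Y' Z Z' (f : @hom FK X X') (g : @hom FK Y Y')
    (h : @hom FK Z Z') :
  dec (α X' Y' Z') \o ((f ⊗m g) ⊗m h) = (f ⊗m (g ⊗m h)) \o dec (α X Y Z).
Proof.
elim/dcspW: f => n fl fr s; elim/dcspW: g => m gl gr t; elim/dcspW: h => p hl hr u.
rewrite !dcsp_tensm.
by apply: (decorate_nat (k := α n m p)); first [exact: decor_tensA | coprod_tac].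
Qed.

Lemma dcospan_lunit_nat X X' (f : @hom FK X X') :
  dec (coprod_lunit S X') \o (@idm FK 0 ⊗m f) = f \o dec (coprod_lunit S X).
Proof.
elim/dcspW: f => n l r s; rewrite [_ ⊗m _]dcsp_tensm.
apply: (decorate_nat (k := coprod_lunit S n)); [coprod_tac | coprod_tac |].
by rewrite decor_tens0l fmapMA copair_inr fmap1 comp1m.
Qed.

Lemma dcospan_runit_nat X X' (f : @hom FK X X') :
  dec (coprod_runit S X') \o (f ⊗m @idm FK 0) = f \o dec (coprod_runit S X).
Proof.
elim/dcspW: f => n l r s; rewrite [_ ⊗m _]dcsp_tensm.
apply: (decorate_nat (k := coprod_runit S n)); [coprod_tac | coprod_tac |].
by rewrite decor_tens0r fmapMA copair_inl fmap1 comp1m.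
Qed.

Lemma dcospan_braid_nat X X' Y Y' (f : @hom FK X X') (g : @hom FK Y Y') :
  dec (σ X' Y') \o (f ⊗m g) = (g ⊗m f) \o dec (σ X Y).
Proof.
elim/dcspW: f => n fl fr s; elim/dcspW: g => m gl gr t; rewrite !dcsp_tensm.
by apply: (decorate_nat (k := σ n m));
  first [exact: decor_tens_braid | coprod_tac].
Qed.

(** Since [decorate] preserves identities, composites and sums, an equation [e]
    between cospans transfers to their images. *)
Ltac by_cospan e :=
  move: (congr1 (@decorate _ _) e);
  rewrite /= !(decorateM, decorate_tens, decorate1); exact.

Local Notation KM := (cospan_symmetric S hC).

Definition dcospan_monoidal : Monoidal FK.
Proof.
refine (@Build_Monoidal FK 0 (coprod S) dcospan_tensm
  dcospan_tensm1 dcospan_tensmM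
  (fun X Y Z => decorate_iso (assoc KM X Y Z))
  (fun X => decorate_iso (lunit KM X))
  (fun X => decorate_iso (runit KM X))
  dcospan_assoc_nat dcospan_lunit_nat dcospan_runit_nat _ _).
- abstract (move=> W X Y Z; by_cospan (pentagon KM W X Y Z)).
- abstract (move=> X Y; by_cospan (triangle KM X Y)).
Defined.

Definition dcospan_braided : Braided FK.
Proof.
refine (@Build_Braided FK dcospan_monoidal
  (fun X Y => decorate_iso (braid KM X Y)) dcospan_braid_nat _ _).
- abstract (move=> X Y Z; by_cospan (hexagon1 KM X Y Z)).
- abstract (move=> X Y Z; by_cospan (hexagon2 KM X Y Z)).
Defined.

Definition dcospan_symmetric : Symmetric FK.
Proof.
exists dcospan_braided; abstract (move=> X Y; by_cospan (braidK KM X Y)).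
Defined.

(** * The hypergraph structure *)

Local Notation KH := (cospan_hypergraph S hC).

Definition dcospan_frob X : @SCFMonoid FK dcospan_symmetric X.
Proof.
pose B := frob KH X.
exists (decorate (mu B)) (decorate (eta B)) (decorate (delta B)) (decorate (eps B)).
- abstract (by_cospan (mu_assoc B)).
- abstract (by_cospan (mu_unitl B)).
- abstract (by_cospan (mu_unitr B)).
- abstract (by_cospan (mu_comm B)).
- abstract (by_cospan (delta_assoc B)).
- abstract (by_cospan (delta_unitl B)).
- abstract (by_cospan (delta_unitr B)).
- abstract (by_cospan (delta_comm B)).
- abstract (by_cospan (frobenius_l B)).
- abstract (by_cospan (frobenius_r B)).
- abstract (by_cospan (special B)).
Defined.

Lemma dcospan_interchange W X Y Z :
  @interchange FK dcospan_symmetric W X Y Z = decorate (@interchange K KM W X Y Z).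
Proof. by rewrite /interchange !(decorateM, decorate_tens, decorate1). Qed.

Definition dcospan_hypergraph : Hypergraph FK.
Proof.
exists dcospan_symmetric dcospan_frob.
- abstract (move=> X Y; rewrite dcospan_interchange; by_cospan (mu_tens KH X Y)).
- abstract (move=> X Y; by_cospan (eta_tens KH X Y)).
- abstract (move=> X Y; rewrite dcospan_interchange; by_cospan (delta_tens KH X Y)).
- abstract (move=> X Y; by_cospan (eps_tens KH X Y)).
Defined.

(** * The embedding of cospans *)

(** All comparison maps are identities, so that the monoidal laws say that
    [decorate] maps each structure map to its namesake. *)
Definition decorate_lax : LaxBraidedFunctor KM dcospan_symmetric.
Proof.
exists decorate_functor (fun X Y => @idm FK (X + Y)) (@idm FK 0).
- abstract (by move=> *; rewrite comp1m compm1 /= decorate_tens).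
- abstract (by move=> *; rewrite !tensm1 !compm1 comp1m).
- abstract (by move=> *; rewrite !tensm1 !compm1).
- abstract (by move=> *; rewrite !tensm1 !compm1).
- abstract (by move=> *; rewrite compm1 comp1m).
Defined.

Definition decorate_strong : StrongSymmetricFunctor KM dcospan_symmetric.
Proof.
exists decorate_lax (fun X Y => @idm FK (X + Y)) (@idm FK 0);
  abstract (by move=> *; rewrite comp1m).
Defined.

Definition decorate_hypergraph : HypergraphFunctor KH dcospan_hypergraph.
Proof.
exists decorate_strong; abstract (by move=> X; rewrite ?comp1m ?compm1).
Defined.

Lemma decorate_wide_embedding : wide_embedding decorate_hypergraph.
Proof. by split; [exact: decorate_inj | exists id]. Qed.

End DecoratedCospanHypergraph.

Theorem theorem3p4 (C : Category) (hC : has_finite_colimits C) (S : Coproducts C)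
    (D : Category) (N : Braided D) (F : LaxBraidedFunctor (coprod_braided S) N) :
  exists (H : Hypergraph (FCospan hC F))
         (E : HypergraphFunctor (cospan_hypergraph S hC) H),
    wide_embedding E.
Proof.
exists (dcospan_hypergraph hC F), (decorate_hypergraph hC F).
exact: decorate_wide_embedding.
Qed.
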